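(* Let $G$ be a graph of order $n$ with super domination number $\gamma_{sp}(G)$. Then $$C_s(G)\geq \left\lfloor \frac{n}{\gamma_{sp}(G)-1}\right\rfloor.$$
   Context: All graphs are finite, simple and undirected. The order of $G$ is $|V(G)|$. $N(v)$ denotes the open neighborhood of a vertex $v$, and for $S\subseteq V(G)$ we write $\overline{S}=V(G)\setminus S$. A set $S\subseteq V(G)$ is a dominating set if every vertex of $\overline{S}$ is adjacent to a vertex of $S$. A dominating set $S$ is a super dominating set if for every $u\in\overline{S}$ there exists $v\in S$ with $N(v)\cap\overline{S}=\{u\}$. The super domination number $\gamma_{sp}(G)$ is the minimum cardinality of a super dominating set of $G$. A super coalition partition of $G$ is a partition $\{A_1,\dots,A_k\}$ of $V(G)$ (into nonempty parts) such that (i) no part $A_i$ is a super dominating set of $G$, and (ii) for every part $A_i$ there is at least one distinct part $A_j$ ($j\neq i$) such that $A_i\cup A_j$ is a super dominating set of $G$. The super coalition number $C_s(G)$ is the maximum cardinality of a super coalition partition of $G$, with $C_s(G)=0$ if $G$ admits no super coalition partition. *)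

(* Defs.v *)
From mathcomp Require Import all_boot.

Set Implicit Arguments.
Unset Strict Implicit.
Unset Printing Implicit Defensive.

(* A finite simple undirected graph on V is given by an adjacency relation
   e : rel V; symmetry and irreflexivity are hypotheses of the theorem. *)

Definition open_neigh (V : finType) (e : rel V) (v : V) : {set V} :=
  [set u | e v u].

Definition dominating (V : finType) (e : rel V) (S : {set V}) : bool :=
  [forall u in ~: S, exists v in S, e u v].

Definition super_dominating (V : finType) (e : rel V) (S : {set V}) : bool :=
  dominating e S &&
  [forall u in ~: S, exists v in S, open_neigh e v :&: ~: S == [set u]].

Lemma super_dominating_setT (V : finType) (e : rel V) :
  super_dominating e [set: V].
Proof.
by apply/andP; split; apply/forall_inP => u; rewrite setCT inE.
Qed.

(* The minimum is over a nonempty family, by super_dominating_setT. *)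
Definition super_domination_number (V : finType) (e : rel V) : nat :=
  #|[arg min_(S < [set: V] | super_dominating e S) #|S| ]|.

Definition super_coalition_partition (V : finType) (e : rel V)
    (P : {set {set V}}) : bool :=
  [&& partition P [set: V],
      [forall A in P, ~~ super_dominating e A] &
      [forall A in P, exists B in P,
        (B != A) && super_dominating e (A :|: B)]].

(* The maximum over the empty family is 0. *)
Definition super_coalition_number (V : finType) (e : rel V) : nat :=
  \max_(P : {set {set V}} | super_coalition_partition e P) #|P|.

(* Main.v *)
Require Import Defs.
From mathcomp Require Import all_boot zify.

(** Write [g] for the super domination number and let [S] be a minimum super
    dominating set. Choosing for every [u] outside [S] a vertex [v] of [S] whose
    only neighbour outside [S] is [u] gives a set [T] of partners, and the edges
    between [~: S] and [T] form an induced matching; hence [~: T] is again super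
    dominating and [n <= 2 g]. For [g >= 2] only three cases remain.
    - If [n = 2 g], then [T = S], so [S] and [~: S] are both super dominating;
      splitting each in two gives four parts, and [n %/ (g - 1) <= 4].
    - If [n = 2 g - 1], then [S = w |: T] for one vertex [w], and the parts
      [[set w]], [T], [~: S] work since [S] and [~: T] are super dominating;
      moreover [n %/ (g - 1) <= 3].
    - If [n <= 2 (g - 1)], any two parts with fewer than [g] vertices work. *)

Section SuperDomination.

Variables (V : finType) (e : rel V).
Implicit Types S T : {set V}.

Lemma super_domination_number_min S :
  super_dominating e S -> super_domination_number e <= #|S|.
Proof.
rewrite /super_domination_number => sdS.
by case: arg_minnP => [|M _]; [exact: super_dominating_setT | apply].
Qed.

Lemma super_domination_numberP :
  exists2 S, super_dominating e S & #|S| = super_domination_number e.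
Proof.
rewrite /super_domination_number.
by case: arg_minnP => [|M sdM _]; [exact: super_dominating_setT | exists M].
Qed.

Lemma small_not_super_dominating S :
  #|S| < super_domination_number e -> ~~ super_dominating e S.
Proof. by rewrite ltnNge; apply: contra => /super_domination_number_min. Qed.

(** A vertex of [S] whose only neighbour outside [S] is [u] is adjacent to [u], so by symmetry it
    also dominates [u]. *)
Lemma super_dominatingP S : symmetric e ->
  reflect {in ~: S, forall u, exists2 v, v \in S & open_neigh e v :&: ~: S = [set u]}
          (super_dominating e S).
Proof.
move=> e_sym; apply: (iffP andP) => [[_ /forall_inP sdS] u /sdS|sdS].
  by case/exists_inP => v vS /eqP; exists v.
split; apply/forall_inP => u /sdS [v vS Nv]; apply/exists_inP; exists v => //.
  have: u \in open_neigh e v :&: ~: S by rewrite Nv set11.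
  by rewrite !inE e_sym => /andP[].
exact/eqP.
Qed.

Lemma super_dominating_partners S : symmetric e -> super_dominating e S ->
  exists T, [/\ T \subset S, #|T| = #|~: S| & super_dominating e (~: T)].
Proof.
move=> e_sym /(super_dominatingP S e_sym) sdS.
pose partner u := odflt u [pick v in S | open_neigh e v :&: ~: S == [set u]].
have partnerP : {in ~: S, forall u,
    partner u \in S /\ open_neigh e (partner u) :&: ~: S = [set u]}.
  move=> u /sdS [v vS Nv]; rewrite /partner.
  by case: pickP => [w /andP[wS /eqP]|/(_ v)] //; rewrite vS Nv eqxx.
(* This is the induced matching; it yields both the injectivity of [partner] and the private
   neighbours for [~: T]. *)
have adj_partner : {in ~: S &, forall u u', e (partner u) u' = (u' == u)}.
  move=> u u' uS u'S; have [_ /setP/(_ u')] := partnerP u uS.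
  by rewrite in_setI in_set u'S andbT in_set1.
have partner_inj : {in ~: S &, injective partner}.
  move=> u u' uS u'S eq_uu'; apply/eqP.
  by rewrite -adj_partner // -eq_uu' adj_partner.
exists (partner @: ~: S); rewrite card_in_imset //; split=> //.
  by apply/subsetP => _ /imsetP[u /partnerP[? _] ->].
apply/super_dominatingP => // v; rewrite setCK => /imsetP[u uS ->].
(* The matching is read backwards: [u] serves its own partner, and it avoids [T] because [T] lies in
   [S]. *)
exists u.
  rewrite inE; apply/imsetP => -[u' /partnerP[u'S _] eq_u].
  by rewrite eq_u inE u'S in uS.
apply/setP => x; rewrite in_setI in_set in_set1.
apply/andP/eqP => [[eux /imsetP[u' u'S def_x]]|->].
  by move: eux; rewrite def_x e_sym adj_partner // => /eqP->.
by rewrite e_sym adj_partner // eqxx imset_f.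
Qed.

(** Encoding the partition as the fibers of a labelling makes the parts disjoint and covering at
    once; surjectivity makes them nonempty and distinct, so there are [#|I|] of them. *)
Lemma super_coalition_number_fibers (I : finType) (f : V -> I) :
  (forall i, exists x, f x = i) ->
  (forall i, #|f @^-1: [set i]| < super_domination_number e) ->
  (forall i, exists2 j, j != i & super_dominating e (f @^-1: [set i; j])) ->
  #|I| <= super_coalition_number e.
Proof.
move=> f_surj small coalition.
pose fiber i := f @^-1: [set i].
have fiber_inj : injective fiber.
  move=> i j /setP eq_ij; have [x fx] := f_surj i.
  by have := eq_ij x; rewrite !inE fx eqxx => /esym/eqP.
rewrite -cardsT -(card_imset setT fiber_inj) /super_coalition_number.
apply: (@leq_bigmax_cond _ _ (fun P : {set {set V}} => #|P|)).
apply/and3P; split.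
- apply/and3P; split.
  + apply/eqP/setP => x; rewrite inE; apply/bigcupP.
    by exists (fiber (f x)); rewrite ?imset_f ?inE.
  + apply/trivIsetP => _ _ /imsetP[i _ ->] /imsetP[j _ ->].
    rewrite (inj_eq fiber_inj) => ne_ij; rewrite -setI_eq0.
    apply/eqP/setP => x; rewrite !inE.
    by apply: contra_neqF ne_ij => /andP[/eqP <- /eqP].
  + apply/imsetP => -[i _ /setP i0]; have [x fx] := f_surj i.
    by have := i0 x; rewrite !inE fx eqxx.
- apply/forall_inP => _ /imsetP[i _ ->].
  exact: small_not_super_dominating (small i).
- apply/forall_inP => _ /imsetP[i _ ->]; have [j ne_ji sd_ij] := coalition i.
  apply/exists_inP; exists (fiber j); first exact: imset_f.
  by rewrite (inj_eq fiber_inj) ne_ji -preimsetU.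
Qed.

Lemma super_coalition_number_ge4 S :
  super_dominating e S -> super_dominating e (~: S) ->
  #|S| = super_domination_number e -> #|~: S| = super_domination_number e ->
  1 < super_domination_number e -> 4 <= super_coalition_number e.
Proof.
move=> sdS sdC cS cC g_gt1.
have /card_gt1P[a [a' [aS a'S ne_a]]] : 1 < #|S| by rewrite cS.
have /card_gt1P[b [b' [bS b'S ne_b]]] : 1 < #|~: S| by rewrite cC.
rewrite !inE in bS b'S.
(* The first bit chooses a side, the second splits off [a] from [S] and [b] from [~: S]. *)
pose f x := (x \in S, x \in [set a; b]).
have f_surj i : exists x, f x = i.
  case: i => [[] []]; [exists a | exists a' | exists b | exists b'];
    rewrite /f !inE ?aS ?a'S ?(negPf bS) ?(negPf b'S) ?eqxx ?orbT //.
  - by rewrite eq_sym (negPf ne_a) (negPf (memPn bS a' a'S)).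
  - by rewrite (eq_sym b' b) (negPf ne_b) eq_sym (negPf (memPn b'S a aS)).
have half s c : f @^-1: [set (s, c); (s, ~~ c)] = if s then S else ~: S.
  by apply/setP => x; case: s c => [] [];
    rewrite !inE /f !xpair_eqE; case: (x \in S); case: (x \in [set a; b]).
have -> : 4 = #|{: bool * bool}| by rewrite card_prod card_bool.
apply: (@super_coalition_number_fibers _ f) => // -[s c].
  (* Each part is a proper subset of its side, which has [g] vertices, since the other part of that
     side is nonempty. *)
  have -> : super_domination_number e = #|if s then S else ~: S| by case: s.
  rewrite -(half s c) proper_card // properE preimsetS ?subsetUl //=.
  have [x fx] := f_surj (s, ~~ c); apply/subsetPn; exists x.
    by rewrite !inE fx eqxx orbT.
  by rewrite !inE fx xpair_eqE; case: (s) (c) => [] [].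
exists (s, ~~ c); first by case: (s) (c) => [] [].
by rewrite half; case: s.
Qed.

Lemma super_coalition_number_ge3 S w : w \in S ->
  super_dominating e S -> super_dominating e (w |: ~: S) ->
  #|S| = super_domination_number e -> 0 < #|~: S| < super_domination_number e ->
  1 < super_domination_number e -> 3 <= super_coalition_number e.
Proof.
move=> wS sdS sdC cS /andP[/card_gt0P[b bS] C_lt] g_gt1.
have /card_gt0P[a] : 0 < #|S :\ w| by have := cardsD1 w S; lia.
rewrite !inE in bS * => /andP[ne_aw aS].
have ne_xw x : x \notin S -> x == w = false by move=> /memPn/(_ w wS)/negPf; rewrite eq_sym.
(* The label [None] marks the part [[set w]], which forms a coalition with each of the other two. *)
pose f x := if x == w then None else Some (x \in S).
have fNone : f @^-1: [set None] = [set w].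
  by apply/setP => x; rewrite !inE /f; case: (x == w).
have fSome s : f @^-1: [set Some s] = if s then S :\ w else ~: S.
  apply/setP => x; case: s; rewrite !inE /f; case: (eqVneq x w) => [->|_] //=;
    by rewrite ?wS ?(inj_eq Some_inj) ?eqb_id ?eqbF_neg.
have -> : 3 = #|{: option bool}| by rewrite card_option card_bool.
apply: (@super_coalition_number_fibers _ f) => -[[]|].
- by exists a; rewrite /f (negPf ne_aw) aS.
- by exists b; rewrite /f ne_xw // (negPf bS).
- by exists w; rewrite /f eqxx.
- by rewrite fSome -cS [X in _ < X](cardsD1 w) wS.
- by rewrite fSome.
- by rewrite fNone cards1.
- by exists None; rewrite // preimsetU fSome fNone setUC setD1K.
- by exists None; rewrite // preimsetU fSome fNone setUC.
- by exists (Some true); rewrite // preimsetU fSome fNone setD1K.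
Qed.

Lemma super_coalition_number_ge2 :
  1 < super_domination_number e -> #|V| <= (super_domination_number e - 1).*2 ->
  2 <= super_coalition_number e.
Proof.
move=> g_gt1 V_le; have [S _ cS] := super_domination_numberP.
have /card_gt0P[a aS] : 0 < #|S| by lia.
(* Removing [a] leaves [g - 1] vertices and hence at most [g - 1] in the complement; the two parts
   together give all of [V]. *)
pose f x := x \in S :\ a.
have cA : #|S :\ a| = (super_domination_number e).-1.
  by rewrite -cS (cardsD1 a S) aS.
have cAC : #|~: (S :\ a)| < super_domination_number e.
  by have := cardsC (S :\ a); lia.
have /card_gt0P[b bA] : 0 < #|S :\ a| by lia.
have fE s : f @^-1: [set s] = if s then S :\ a else ~: (S :\ a).
  by apply/setP => x; case: s; rewrite !inE /f !inE ?eqb_id ?eqbF_neg.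
rewrite -card_bool; apply: (@super_coalition_number_fibers _ f) => -[].
- by exists b.
- by exists a; rewrite /f !inE eqxx.
- by rewrite fE cA; lia.
- by rewrite fE.
- by exists false; rewrite // preimsetU !fE setUCr super_dominating_setT.
- by exists true; rewrite // preimsetU !fE setUC setUCr super_dominating_setT.
Qed.

End SuperDomination.

Theorem theorem3p3 (V : finType) (e : rel V)
    (e_sym : symmetric e) (e_irrefl : irreflexive e) :
  #|V| %/ (super_domination_number e - 1) <= super_coalition_number e.
Proof.
set g := super_domination_number e.
(* For [g <= 1] the truncated divisor is 0, and division by 0 returns 0. *)
have [g_le1|g_gt1] := leqP g 1; first by rewrite (eqP g_le1) divn0.
have [S sdS cS] := super_domination_numberP V e.
have [T [sTS cT sdT]] := super_dominating_partners V e S e_sym sdS.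
have cV : #|S| + #|~: S| = #|V| := cardsC S.
have T_le : #|T| <= #|S| := subset_leq_card sTS.
(* For [g >= 2] this applies with [k] equal to 2, 4 and 3, as [2 g < 5 (g - 1)] and
   [2 g - 1 < 4 (g - 1)]. *)
have quotient_le k : #|V| < k.+1 * (g - 1) -> #|V| %/ (g - 1) <= k.
  by rewrite -ltn_divLR ?ltnS //; lia.
have [V_le|V_gt] := leqP #|V| (g - 1).*2.
  apply: leq_trans (super_coalition_number_ge2 _ _ g_gt1 V_le).
  by apply: quotient_le; lia.
(* Now [#|T| = #|V| - g] exceeds [g - 2] and is at most [g], so it is [g] or [g - 1]. *)
have [T_eq|T_neq] := eqVneq #|T| g.
  have eq_TS : T = S by apply/eqP; rewrite eqEcard sTS cS T_eq leqnn.
  have cC : #|~: S| = g by rewrite -cT.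
  apply: leq_trans (super_coalition_number_ge4 V e S sdS _ cS cC g_gt1).
    by apply: quotient_le; lia.
  by rewrite -eq_TS.
have /eqP/cards1P[w def_w] : #|S :\: T| = 1 by rewrite cardsDS //; lia.
have wS : w \in S by have := set11 w; rewrite -def_w inE => /andP[].
have def_C : ~: T = w |: ~: S.
  apply/setP => x; have /setP/(_ x) := def_w; rewrite !inE => <-.
  by have /subsetP/(_ x) := sTS; case: (x \in T) (x \in S) => [] [] // ->.
apply: leq_trans (super_coalition_number_ge3 V e S w wS sdS _ cS _ g_gt1).
- by apply: quotient_le; lia.
- by rewrite -def_C.
- by lia.
Qed.
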